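(* Suppose that under a risk-neutral probability $\mathbb Q$ the spot price is modelled by $S_t=X_t^c+Z_t^\beta$, $t\ge0$, with $X^c$ and $Z^\beta$ as described in the context. (1) The forward price $f(t,T)=\mathbb E^{\mathbb Q}[S_T\mid\mathcal F_t]$ has the explicit representation $f(t,T)=f^c(t,T)+f^\beta(t,T)$, with $$f^c(t,T)=\mathbb E^{\mathbb Q}[X_T^c\mid\mathcal F_t],\qquad f^\beta(t,T)=e^{-\beta(T-t)}Z_t^\beta+\frac{\lambda\,(x\star\nu)}{\beta}\big(1-e^{-\beta(T-t)}\big).$$ (2) The price $f(t,T,\theta)=\frac1\theta\int_T^{T+\theta}f(t,u)\,du$ satisfies $f(t,T,\theta)=f^c(t,T,\theta)+f^\beta(t,T,\theta)$, with $f^c(t,T,\theta)=\frac1\theta\int_T^{T+\theta}f^c(t,u)\,du$ and $$f^\beta(t,T,\theta)=e^{-\beta(T-t)}\Big(\frac{1-e^{-\beta\theta}}{\beta\theta}\Big)Z_t^\beta+\frac{\lambda\,(x\star\nu)}{\beta}\Big[1-e^{-\beta(T-t)}\Big(\frac{1-e^{-\beta\theta}}{\beta\theta}\Big)\Big].$$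
   Context: On a filtered probability space $(\Omega,\mathcal F,(\mathcal F_t)_{t\ge0},\mathbb Q)$, rich enough to accommodate all the random quantities considered, with $\mathcal F_t$ the information available up to time $t$: $X^c_t=X^c_0+\int_0^t\mu_sds+\int_0^t\sigma_sdW_s$ is a continuous Itô semimartingale, with $\mu,\sigma$ adapted càdlàg processes and $W$ an $(\mathcal F_t)$-standard Brownian motion; $Z_t^\beta=\int_0^t\int_{\mathbb R}xe^{-\beta(t-s)}\underline p(ds,dx)$, where $\beta>0$ and $\underline p$ is a Poisson random measure on $[0,\infty)\times\mathbb R$, independent of $W$, with intensity $\lambda\,dt\otimes\nu(dx)$ for some $\lambda>0$ and a probability measure $\nu$ on $\mathbb R$. Here $t\le T$ ($t$ is the quotation time and $T$ the delivery time), and $\theta>0$ is the length of the delivery period $[T,T+\theta]$. Notation: $x\star\nu=\int_{\mathbb R}x\,\nu(dx)$. *)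

(* Defs.v *)
From HB Require Import structures.
From mathcomp Require Import all_boot all_order all_algebra.
From mathcomp Require Import all_classical all_reals all_analysis.
From mathcomp Require Import measurable_realfun.

Set Implicit Arguments.
Unset Strict Implicit.
Unset Printing Implicit Defensive.
Import Order.TTheory GRing.Theory Num.Theory.
Import numFieldNormedType.Exports.
Local Open Scope classical_set_scope.
Local Open Scope ring_scope.

(* Time is represented by the type R; only the instants t >= 0 are ever used.
   A process is a function X : R -> Omega -> R, with X t the value at time t,
   and a sub-sigma-algebra of Omega is given by its collection of events. *)

Section sub_sigma_algebras.
Context d (Omega : measurableType d) (R : realType) (P : probability Omega R).
Implicit Types (G H : set (set Omega)).

Definition measurable_wrt G d' (T : measurableType d') (X : Omega -> T) :=
  forall B, measurable B -> G (X @^-1` B).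

Definition sigma_of d' (T : measurableType d') (I : Type)
    (X : I -> Omega -> T) (J : set I) : set (set Omega) :=
  <<s [set E | exists2 i, J i & exists2 B, measurable B & E = X i @^-1` B] >>.

Definition independent_sigma G H :=
  forall A B, G A -> H B -> P (A `&` B) = (P A * P B)%E.

(* Y is a version of the conditional expectation E[X | G]. *)
Definition is_cond_exp G (X Y : Omega -> R) :=
  [/\ P.-integrable setT (EFin \o X),
      P.-integrable setT (EFin \o Y),
      measurable_wrt G Y &
      forall A, G A ->
        (\int[P]_(w in A) (Y w)%:E = \int[P]_(w in A) (X w)%:E)%E].

Definition cvg_in_prob (Y : nat -> Omega -> R) (Z : Omega -> R) :=
  forall e : R, 0 < e ->
    P [set w | e <= `|Y n w - Z w|] @[n --> \oo] --> 0%E.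

End sub_sigma_algebras.

Section processes.
Context d (Omega : measurableType d) (R : realType) (P : probability Omega R).
Variable F : R -> set (set Omega).
Implicit Types (X W mu sigma : R -> Omega -> R) (s : seq R).

Definition filtration :=
  [/\ forall t, 0 <= t -> sigma_algebra setT (F t),
      forall t, 0 <= t -> F t `<=` measurable &
      forall u t, 0 <= u -> u <= t -> F u `<=` F t].

Definition adapted X := forall t, 0 <= t -> measurable_wrt (F t) (X t).

Definition continuous_path (x : R -> R) := {within `[0, +oo[, continuous x}.

Definition cadlag_path (x : R -> R) :=
  (forall t, 0 <= t -> x u @[u --> t^'+] --> x t) /\
  (forall t, 0 < t -> cvg (x u @[u --> t^'-])).

Definition standard_brownian_motion W :=
  [/\ adapted W,
      {ae P, forall w, W 0 w = 0},
      {ae P, forall w, continuous_path (W ^~ w)},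
      forall u t, 0 <= u -> u < t ->
        independent_sigma P (F u)
          (preimage_set_system setT (W t \- W u) measurable) &
      forall u t B, 0 <= u -> u < t -> measurable B ->
        P ((W t \- W u) @^-1` B) = normal_prob 0 (Num.sqrt (t - u)) B].

(* The points 0 = t_0 < t_1 < ... < t_k = t of the partition s of [0, t];
   s lists t_1, ..., t_k. *)
Definition point t s i : R := nth t (0 :: s) i.

(* H = \sum_i xi_i 1_(]t_i, t_(i+1)]) with xi_i bounded, F_(t_i)-measurable. *)
Definition simple_integrand t s (xi : nat -> Omega -> R) :=
  itv_partition 0 t s /\
  forall i, (i < size s)%N ->
    measurable_wrt (F (point t s i)) (xi i) /\
    exists M : R, forall w, `|xi i w| <= M.

Definition simple_process t s (xi : nat -> Omega -> R) (u : R) (w : Omega)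
    : R :=
  \sum_(i < size s) xi i w * \1_`]point t s i, point t s i.+1] u.

Definition simple_integral W t s (xi : nat -> Omega -> R) (w : Omega) : R :=
  \sum_(i < size s) xi i w * (W (point t s i.+1) w - W (point t s i) w).

(* Y = \int_0^t sigma dW: there are simple processes H^n with
   \int_0^t (H^n - sigma)^2 du -> 0 and \int_0^t H^n dW -> Y in probability. *)
Definition is_ito_integral W sigma t (Y : Omega -> R) :=
  measurable_fun setT Y /\
  exists (s : nat -> seq R) (xi : nat -> nat -> Omega -> R),
    [/\ forall n, simple_integrand t (s n) (xi n),
        cvg_in_prob P
          (fun n w => \int[lebesgue_measure]_(u in `[0, t])
             (simple_process t (s n) (xi n) u w - sigma u w) ^+ 2)
          (cst 0) &
        cvg_in_prob P (fun n => simple_integral W t (s n) (xi n)) Y].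

Definition continuous_ito_semimartingale W mu sigma X :=
  [/\ adapted mu /\ (forall w, cadlag_path (mu ^~ w)),
      adapted sigma /\ (forall w, cadlag_path (sigma ^~ w)),
      adapted X,
      {ae P, forall w, continuous_path (X ^~ w)} &
      exists I : R -> Omega -> R, forall t, 0 <= t ->
        is_ito_integral W sigma t (I t) /\
        {ae P, forall w,
          X t w = X 0 w + \int[lebesgue_measure]_(u in `[0, t]) mu u w
                  + I t w}].

End processes.

Section poisson_random_measures.
Context d (Omega : measurableType d) (R : realType) (P : probability Omega R).

(* The second argument of poisson_prob is a dummy. *)
Definition poisson_random_measure d' (E : measurableType d')
    (m : set E -> \bar R) (p : R.-ker Omega ~> E) :=
  [/\ forall A, measurable A -> (m A < +oo)%E -> forall k : nat,
        P [set w | p w A = k%:R%:E] = poisson_prob (fine (m A)) 0 [set k],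
      forall A, measurable A -> m A = +oo%E -> {ae P, forall w, p w A = +oo%E} &
      forall n (A : 'I_n -> set E), (forall i, measurable (A i)) ->
        trivIset setT A ->
        forall B : 'I_n -> set \bar R, (forall i, measurable (B i)) ->
        P (\bigcap_i [set w | B i (p w (A i))]) =
        (\prod_(i < n) P [set w | B i (p w (A i))])%E].

(* lambda dt (x) nu(dx) on [0, +oo[ x R *)
Definition jump_intensity (lambda : R) (nu : probability R R)
    (A : set (R * R)) : \bar R :=
  (lambda%:E * (lebesgue_measure \x nu) (A `&` (`[0%R, +oo[ `*` setT)))%E.

(* p is a Poisson random measure relative to the filtration F: its restriction
   to [0, t] x R is known at time t, its restriction to ]t, +oo[ x R is
   independent of F t. *)
Definition filtered_poisson_random_measure (F : R -> set (set Omega))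
    (lambda : R) (nu : probability R R) (p : R.-ker Omega ~> (R * R)%type) :=
  [/\ poisson_random_measure (jump_intensity lambda nu) p,
      forall t : R, 0 <= t -> forall A : set (R * R), measurable A ->
        A `<=` `[0, t] `*` setT -> measurable_wrt (F t) (p ^~ A) &
      forall t : R, 0 <= t ->
        independent_sigma P (F t)
          (sigma_of (fun (A : set (R * R)) w => p w A)
             [set A : set (R * R) | measurable A /\ A `<=` `]t, +oo[ `*` setT])].

Definition independent_of_process (p : R.-ker Omega ~> (R * R)%type)
    (W : R -> Omega -> R) :=
  independent_sigma P
    (sigma_of (fun (A : set (R * R)) w => p w A)
       [set A : set (R * R) | measurable A /\ A `<=` `[0, +oo[ `*` setT])
    (sigma_of W [set t | 0 <= t]).

(* Z_t^beta; the integral runs over s in ]0, t]. *)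
Definition spike (beta : R) (p : R.-ker Omega ~> (R * R)%type)
    (t : R) (w : Omega) : R :=
  \int[p w]_(z in `]0, t] `*` setT) (z.2 * expR (- (beta * (t - z.1)))).

(* u |-> f u is a jointly measurable version of u |-> E[Y u | G] on [a, b], so
   that the integrals of its paths over [a, b] make sense. *)
Definition forward_curve (G : set (set Omega)) (Y : R -> Omega -> R) (a b : R)
    (f : R -> Omega -> R) :=
  measurable_fun (`[a, b] `*` setT) (fun z : R * Omega => f z.1 z.2) /\
  forall u, a <= u <= b -> is_cond_exp P G (Y u) (f u).

Definition delivery_price (T theta : R) (f : R -> Omega -> R) (w : Omega) : R :=
  theta^-1 * \int[lebesgue_measure]_(u in `[T, T + theta]) f u w.

End poisson_random_measures.

(* Main.v *)
Require Import Defs.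
From HB Require Import structures.
From mathcomp Require Import all_boot all_order all_algebra.
From mathcomp Require Import all_classical all_reals all_analysis.
From mathcomp Require Import measurable_realfun.
From mathcomp Require Import ring.

(** Splitting the jump integral at [t] gives, almost surely,
    [spike T = exp (- beta (T - t)) * spike t + Y], where [Y] integrates over the
    jumps in []t, T]]. The first term is known at time [t]. For an event [A] of
    [F t] and a set [U] of jumps after [t], independence makes the count [p U]
    Poisson even on [A], so that its integral over [A] is [P A] times the
    intensity of [U]; passing from indicators to functions, the integral of [Y]
    over [A] is [P A] times the integral of the jump function against the
    intensity, which is explicit. For the delivery price, the identity of
    conditional expectations holds almost surely for each [u], hence by Tonelli
    almost surely for almost every [u], and is integrated over the period. *)

Set Implicit Arguments.
Unset Strict Implicit.
Unset Printing Implicit Defensive.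
Import Order.TTheory GRing.Theory Num.Theory.
Import numFieldNormedType.Exports.
Local Open Scope classical_set_scope.
Local Open Scope ring_scope.

(** * Integration against a mixture of measures *)

Section integral_mixture.
Context d d' (X : measurableType d) (Y : measurableType d') (R : realType).
Implicit Types (l : X -> {measure set Y -> \bar R}) (f : Y -> \bar R).
Local Open Scope ereal_scope.

Lemma integral_mrestr (m : {measure set Y -> \bar R}) D (mD : measurable D) f :
  \int[m]_(y in D) f y = \int[mrestr m mD]_y (f \_ D) y.
Proof.
rewrite -integral_mkcond; apply: eq_measure_integral => A mA AD.
by rewrite /= /mrestr setIidl.
Qed.

(** Measurability is asked of subsets of [D] alone: for the spike at time [t], the jump counts known
    at that time are those of sets of jumps up to [t]. *)
Lemma measurable_fun_integral_restr l D f : measurable D ->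
  (forall U, measurable U -> U `<=` D -> measurable_fun setT (l ^~ U)) ->
  (forall y, D y -> 0 <= f y) -> measurable_fun D f ->
  measurable_fun setT (fun x => \int[l x]_(y in D) f y).
Proof.
move=> mD ml f0 mf; under eq_fun do rewrite integral_mrestr.
apply: (@measurable_fun_integral_kernel _ _ _ _ _ (fun x => mrestr (l x) mD)).
- by move=> U mU; apply: ml; [exact: measurableI|exact: subIsetr].
- by move=> y; rewrite patchE; case: ifPn => // /set_mem; exact: f0.
- exact/(measurable_restrictT _ _).1.
Qed.

Import HBNNSimple.

(** Both sides are additive in [f] and commute with increasing limits, so that approximation by
    simple functions reduces the identity to [lm], the case of indicators. *)
Let integral_mixtureT (mu : {measure set X -> \bar R}) l
    (m : {measure set Y -> \bar R}) B f : measurable B ->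
  (forall U, measurable U -> measurable_fun setT (l ^~ U)) ->
  (forall U, measurable U -> \int[mu]_(x in B) l x U = m U) ->
  (forall y, 0 <= f y) -> measurable_fun setT f ->
  \int[mu]_(x in B) (\int[l x]_y f y) = \int[m]_y f y.
Proof.
move=> mB ml lm f0 mf; pose g := nnsfun_approx measurableT mf.
have ndg y : {homo (fun n => (g n y)%:E) : a b / (a <= b)%N >-> a <= b}.
  by move=> a b ab; rewrite lee_fin; exact/lefP/nd_nnsfun_approx.
have limg (n : {measure set Y -> \bar R}) :
    \int[n]_y f y = limn (fun k => \int[n]_y (g k y)%:E).
  rewrite -monotone_convergence//; last 2 first.
  - by move=> k; exact/measurable_EFinP.
  - by move=> k y _; rewrite lee_fin.
  by apply: eq_integral => y _; apply/esym/cvg_lim => //; exact: cvg_nnsfun_approx.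
under eq_integral do rewrite limg.
rewrite limg monotone_convergence//; last 3 first.
- move=> n; apply: measurable_funTS; apply: measurable_fun_integral_kernel => //.
  + by move=> y; rewrite lee_fin.
  + exact/measurable_EFinP.
- by move=> n y _; apply: integral_ge0 => // z _; rewrite lee_fin.
- move=> x _ a b ab; apply: ge0_le_integral => //.
  + by move=> z _; rewrite lee_fin.
  + exact/measurable_EFinP.
  + exact/measurable_EFinP.
  + by move=> z _; exact: ndg.
congr (limn _); apply/funext => n.
under eq_integral do rewrite integralT_nnsfun sintegralE.
rewrite integralT_nnsfun sintegralE ge0_integral_fsum//; last 2 first.
- move=> r; apply: measurable_funeM; apply: measurable_funTS; exact: ml.
- by move=> r x _; exact: nnsfun_mulemu_ge0.
apply: eq_fsbigr => r _; have [r0|r0] := leP 0%R r.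
  by rewrite ge0_integralZl//= ?lm//; apply: measurable_funTS; exact: ml.
(* A negative [r] is not a value of the nonnegative [g n]: its preimage is empty and both terms
   vanish. *)
rewrite preimage_nnfun0// measure0 mule0; apply: integral0_eq => x _.
by rewrite measure0 mule0.
Qed.

(** Restricting every measure to [D] turns the hypotheses on subsets of [D] into hypotheses on all
    measurable sets. *)
Lemma integral_mixture (mu : {measure set X -> \bar R}) l
    (m : {measure set Y -> \bar R}) B D f : measurable B -> measurable D ->
  (forall U, measurable U -> U `<=` D -> measurable_fun setT (l ^~ U)) ->
  (forall U, measurable U -> U `<=` D -> \int[mu]_(x in B) l x U = m U) ->
  (forall y, D y -> 0 <= f y) -> measurable_fun D f ->
  \int[mu]_(x in B) (\int[l x]_(y in D) f y) = \int[m]_(y in D) f y.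
Proof.
move=> mB mD ml lm f0 mf; rewrite integral_mrestr.
under eq_integral do rewrite integral_mrestr.
apply: (@integral_mixtureT mu (fun x => mrestr (l x) mD) (mrestr m mD)) => //.
- by move=> U mU; apply: ml; [exact: measurableI|exact: subIsetr].
- by move=> U mU; apply: lm; [exact: measurableI|exact: subIsetr].
- by move=> y; rewrite patchE; case: ifPn => // /set_mem; exact: f0.
- exact/(measurable_restrictT _ _).1.
Qed.

End integral_mixture.

(** * The Poisson law and its mean *)

Section poisson_mean.
Context (R : realType).
Local Open Scope ereal_scope.

Lemma poisson_prob1 (r : R) k : (0 < r)%R ->
  poisson_prob r 0 [set k] = (poisson_pmf r k)%:E.
Proof.
by move=> r0; rewrite /poisson_prob r0 esum_set1// lee_fin poisson_pmf_ge0.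
Qed.

Lemma poisson_prob_series (r : R) : \sum_(k <oo) poisson_prob r 0 [set k] = 1.
Proof.
rewrite -(probability_setT (poisson_prob r 0)).
have -> : [set: nat] = \bigcup_k [set k] by apply/seteqP; split => // k _; exists k.
rewrite measure_bigcup//; first by apply: eq_eseriesl => k; rewrite in_setT.
apply/trivIsetP => i j _ _ ij; apply/seteqP; split => // k [/= -> ji].
by rewrite ji eqxx in ij.
Qed.

(** For [r > 0] the term of index 0 vanishes, and [k r^k / k! = r r^(k-1) / (k-1)!] turns the others
    into [r] times the Poisson weights, which sum to 1. *)
Lemma poisson_mean (r : R) : (0 <= r)%R ->
  \sum_(k <oo) k%:R%:E * poisson_prob r 0 [set k] = r%:E.
Proof.
rewrite le_eqVlt => /predU1P[<-|r0].
  (* At rate zero [poisson_prob] is the Dirac mass at 0. *)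
  rewrite eseries0// => k _ _; rewrite /poisson_prob ltxx diracE.
  by case: k => [|k]; rewrite ?mul0e// memNset ?mule0//= => -[].
have pk0 k : 0 <= k%:R%:E * poisson_prob r 0 [set k].
  by rewrite mule_ge0// lee_fin ler0n.
rewrite nneseries_recl// mul0e add0e.
transitivity (\sum_(0 <= k <oo) r%:E * poisson_prob r 0 [set k]).
  rewrite -(nneseries_addn 1) => [|k]; last exact: pk0.
  apply: eq_eseriesr => k _.
  rewrite addn1 !poisson_prob1// -!EFinM /poisson_pmf r0; congr EFin.
  rewrite factS natrM invfM exprS.
  have k0 : (k.+1%:R != 0 :> R)%R by rewrite pnatr_eq0.
  transitivity (k.+1%:R / k.+1%:R * (r * (r ^+ k / k`!%:R * expR (- r))))%R.
    by ring.
  by rewrite mulfV// mul1r.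
rewrite nneseriesZl//.
by rewrite poisson_prob_series mule1.
Qed.

Variables (d : measure_display) (T : measurableType d) (P : probability T R).

(** Since the Poisson weights sum to 1, [X] takes natural values at almost every point of [A], and
    its integral there is the series of [k] times the probability of [A] meeting [X = k]. *)
Lemma integral_poisson (A : set T) (X : T -> \bar R) (r : R) :
  measurable A -> measurable_fun setT X -> (forall w, 0 <= X w) -> (0 <= r)%R ->
  (forall k : nat, P (A `&` [set w | X w = k%:R%:E]) =
                   P A * poisson_prob r 0 [set k]) ->
  \int[P]_(w in A) X w = P A * r%:E.
Proof.
move=> mA mX X0 r0 PX; pose B k := A `&` [set w | X w = k%:R%:E].
have mB k : measurable (B k).
  apply: measurableI => //; rewrite -[X in measurable X]setTI.
  exact: (mX measurableT [set k%:R%:E] (emeasurable_set1 _)).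
have tB : trivIset setT B.
  apply/trivIsetP => i j _ _ ij; apply/seteqP; split => // w [[_ /= Xi] [_ /=]].
  by rewrite Xi => -[] /eqP; rewrite eqr_nat (negbTE ij).
have BA : \bigcup_k B k `<=` A by apply: bigcup_sub => k _; exact: subIsetl.
have mU : measurable (\bigcup_k B k) by exact: bigcup_measurable.
have PB : P (\bigcup_k B k) = P A.
  rewrite measure_bigcup//=.
  rewrite (eq_eseriesl (Q := xpredT)) => [|k]; last by rewrite in_setT.
  rewrite (eq_eseriesr (fun k _ => PX k)).
  have : P A \is a fin_num by exact: fin_num_measure.
  by move=> /fineK <-; rewrite nneseriesZl// poisson_prob_series mule1.
(* The part of [A] where [X] is not a natural number has probability [P A - P A = 0] and is
   discarded. *)
rewrite (@ge0_negligible_integral _ _ _ P A (A `\` \bigcup_k B k))//; last 3 first.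
- exact: measurableD.
- exact: measurable_funTS.
- rewrite measureD ?ltey_eq ?fin_num_measure// (setIidr BA).
  by rewrite [X in _ - X]PB subee// fin_num_measure.
rewrite setDD setIidr// ge0_integral_bigcup//; last exact: measurable_funTS.
rewrite -(poisson_mean r0).
have PA : P A \is a fin_num by exact: fin_num_measure.
rewrite -[in RHS](fineK PA) -nneseriesZl; last first.
  by move=> k _; rewrite mule_ge0// lee_fin ler0n.
apply: eq_eseriesr => k _.
rewrite (eq_integral (cst k%:R%:E)).
  by rewrite integral_cst// muleCA fineK//; congr (_ * _); exact: PX.
by move=> w /set_mem[_].
Qed.
End poisson_mean.

(** * Campbell's formula on an event *)

Section campbell.
Context d d' (Omega : measurableType d) (E : measurableType d') (R : realType).
Variables (P : probability Omega R) (p : R.-ker Omega ~> E).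
Variables (m : {measure set E -> \bar R}) (D : set E).
Hypotheses (mD : measurable D) (mDoo : (m D < +oo)%E).
Local Open Scope ereal_scope.

(* The Poisson laws under [P (. | A)], with the denominator [P A] cleared. *)
Definition poisson_given (A : set Omega) :=
  measurable A /\ forall U, measurable U -> U `<=` D -> forall k : nat,
    P (A `&` [set w | p w U = k%:R%:E]) =
    P A * poisson_prob (fine (m U)) 0 [set k].

Let mp U : measurable U -> measurable_fun setT (p ^~ U).
Proof. exact: measurable_kernel. Qed.

(** The Poisson mean gives [P A * m U] as the integral of [p U] over [A] for [U] inside [D]; hence
    the mixture of the measures [p w] over [A] is [m] scaled by [P A]. *)
Lemma ge0_campbell A f : poisson_given A ->
  (forall z, D z -> 0 <= f z) -> measurable_fun D f ->
  \int[P]_(w in A) (\int[p w]_(z in D) f z) = P A * \int[m]_(z in D) f z.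
Proof.
move=> [mA pA] f0 mf; have PA : P A \is a fin_num by exact: fin_num_measure.
have PA0 : (0 <= fine (P A))%R by exact: fine_ge0.
rewrite (@integral_mixture _ _ _ _ _ P p (mscale (NngNum PA0) m))//.
- by rewrite ge0_integral_mscale//= fineK.
- by move=> U mU _; exact: mp.
- move=> U mU UD; rewrite /= /mscale/= fineK//.
  have mU0 : m U \is a fin_num.
    by rewrite ge0_fin_numE//; apply: le_lt_trans mDoo; by rewrite le_measure ?inE.
  rewrite -[in RHS](fineK mU0); apply: integral_poisson => //.
  + exact: mp.
  + by move=> k; exact: pA.
Qed.

Variable g : E -> R.
Hypotheses (ig : m.-integrable D (EFin \o g)) (pT : poisson_given setT).

Let mg : measurable_fun D (EFin \o g). Proof. by case/integrableP: ig. Qed.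

Let integrable_campbell f : m.-integrable D f -> (forall z, D z -> 0 <= f z) ->
  P.-integrable setT (fun w => \int[p w]_(z in D) f z).
Proof.
move=> /integrableP[mf foo] f0; apply/integrableP; split.
  by apply: measurable_fun_integral_restr => // U mU _; exact: mp.
under eq_integral do rewrite gee0_abs ?integral_ge0//.
rewrite ge0_campbell// probability_setT mul1e.
by under eq_integral => z /set_mem zD do rewrite -[f z]gee0_abs ?f0//.
Qed.

(** By Campbell's formula the integral of [|g|] against [p w] has finite mean, so it is finite
    almost surely. *)
Lemma ae_integrable_kernel : {ae P, forall w, (p w).-integrable D (EFin \o g)}.
Proof.
have := integrable_campbell (integrable_abse ig) (fun z _ => abse_ge0 _).
move=> /(integrable_ae measurableT); apply: filterS => w /(_ I) pg.
by apply/integrableP; split => //; rewrite ltey_eq pg.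
Qed.

Let ipos := integrable_campbell (integrable_funepos mD ig)
  (fun _ _ => funepos_ge0 _ _).
Let ineg := integrable_campbell (integrable_funeneg mD ig)
  (fun _ _ => funeneg_ge0 _ _).

(** The real-valued integral is 0 where the extended one is infinite, so its absolute value is
    everywhere at most that of the difference of the integrals of the two parts of [g], which is
    integrable. *)
Lemma integrable_kernel_Rintegral :
  P.-integrable setT (EFin \o (fun w => \int[p w]_(z in D) g z)%R).
Proof.
apply: (le_integrable measurableT) (integrableB measurableT ipos ineg) => //.
  apply/measurable_EFinP; apply: (measurableT_comp (fine_measurable measurableT)).
  under eq_fun do rewrite integralE.
  by apply: emeasurable_funB;
    [exact: measurable_int _ ipos|exact: measurable_int _ ineg].
move=> w _; rewrite /Rintegral -integralE /=.
by case: (\int[p w]_(z in D) _) => [r| |]//=; rewrite ?leey.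
Qed.

Lemma campbell A : poisson_given A ->
  \int[P]_(w in A) (\int[p w]_(z in D) g z)%R%:E =
  P A * \int[m]_(z in D) (g z)%:E.
Proof.
move=> pA; have [mA _] := pA.
have sub := @integrableS _ _ _ P setT A _ measurableT mA (@subsetT _ A).
(* The two integrands agree wherever [g] is integrable against [p w], hence almost surely; the
   nonnegative formula then applies to each part. *)
transitivity (\int[P]_(w in A) (\int[p w]_(z in D) (EFin \o g)^\+ z -
                                \int[p w]_(z in D) (EFin \o g)^\- z)).
  apply: ae_eq_integral => //.
  - apply: measurable_funTS; exact: measurable_int _ integrable_kernel_Rintegral.
  - apply: measurable_funTS.
    exact: measurable_int _ (integrableB measurableT ipos ineg).
  - apply: filterS ae_integrable_kernel => w iw _; rewrite -integralE.
    by rewrite /Rintegral fineK//; apply: integrable_fin_num.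
rewrite integralB//; [|exact: sub|exact: sub].
rewrite !ge0_campbell//; [|exact: measurable_funeneg|exact: measurable_funepos].
rewrite -muleBr; [by rewrite -integralE|exact: fin_num_measure|].
by rewrite fin_num_adde_defl// fin_numN integrable_neg_fin_num.
Qed.

End campbell.

(** * Integrals of products of functions of separate variables *)

Section product_integrals.
Context d1 d2 (T1 : measurableType d1) (T2 : measurableType d2) (R : realType).
Variables (m1 : {sigma_finite_measure set T1 -> \bar R}).
Variables (m2 : {sigma_finite_measure set T2 -> \bar R}).
Variables (I : set T1) (a : T1 -> R) (b : T2 -> R).
Hypotheses (mI : measurable I) (ia : m1.-integrable I (EFin \o a)).
Hypothesis (ib : m2.-integrable setT (EFin \o b)).
Local Open Scope ereal_scope.

(** The restriction to [I] is carried by the first factor, so that [f] remains a product. *)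
Let f (z : T1 * T2) := ((a \_ I) z.1 * b z.2)%:E.

Let patch_prod : (fun z : T1 * T2 => (a z.1 * b z.2)%:E) \_ (I `*` setT) = f.
Proof.
apply/funext => -[x y]; rewrite /f !patchE/=.
have -> : ((x, y) \in I `*` setT) = (x \in I).
  by apply/idP/idP; rewrite !inE => // -[].
by case: ifPn; rewrite ?mul0r.
Qed.

Let mIT : measurable (I `*` [set: T2]). Proof. exact: measurableX. Qed.

Let ia' : m1.-integrable setT (EFin \o a \_ I).
Proof. by rewrite -restrict_EFin; exact/(integrable_mkcond _ mI). Qed.

Let integrable_f : (m1 \x m2).-integrable setT f.
Proof.
apply/integrable12ltyP.
  apply/measurable_EFinP; apply: measurable_funM.
  - apply: (measurableT_comp _ measurable_fst).
    by apply/measurable_EFinP; exact: measurable_int _ ia'.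
  - apply: (measurableT_comp _ measurable_snd).
    by apply/measurable_EFinP; exact: measurable_int _ ib.
under eq_integral => x _.
  rewrite (eq_integral (fun y => `|((a \_ I) x)%:E| * `|(b y)%:E|)); last first.
    by move=> y _; rewrite -abseM.
  rewrite ge0_integralZl//; last first.
    by apply: measurableT_comp => //; exact: measurable_int _ ib.
  over.
rewrite ge0_integralZr//.
- apply: lte_mul_pinfty => //.
  + exact: integral_ge0.
  + rewrite ge0_fin_numE ?integral_ge0//; by case/integrableP: ia'.
  + by case/integrableP: ib.
- by apply: measurableT_comp => //; exact: measurable_int _ ia'.
- exact: integral_ge0.
Qed.

Lemma integrable_prod :
  (m1 \x m2).-integrable (I `*` setT) (fun z => (a z.1 * b z.2)%:E).
Proof. by apply/(integrable_mkcond _ mIT); rewrite patch_prod. Qed.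

Lemma integral_prod :
  \int[m1 \x m2]_(z in I `*` setT) (a z.1 * b z.2)%:E =
  \int[m1]_(x in I) (a x)%:E * \int[m2]_y (b y)%:E.
Proof.
have fb : \int[m2]_y (b y)%:E \is a fin_num by exact: integrable_fin_num.
rewrite integral_mkcond patch_prod -integral12_prod_meas1//.
rewrite [in RHS]integral_mkcond -(fineK fb) -integralZr//; last first.
  by rewrite restrict_EFin.
apply: eq_integral => x _; rewrite /fubini_F.
rewrite (eq_integral (fun y => ((a \_ I) x)%:E * (b y)%:E)) => [|y _];
  last exact: EFinM.
by rewrite integralZl// fineK// restrict_EFin.
Qed.

End product_integrals.

(** * Integrals against a scaled measure *)

Section mscale.
Context d (T : measurableType d) (R : realType) (m : {measure set T -> \bar R}).
Variables (k : {nonneg R}) (D : set T) (f : T -> \bar R).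
Hypotheses (mD : measurable D) (imf : m.-integrable D f).
Local Open Scope ereal_scope.

Lemma integrable_mscale : (mscale k m).-integrable D f.
Proof.
have [mf foo] := integrableP _ _ _ imf; apply/integrableP; split => //.
rewrite ge0_integral_mscale//; last exact: measurableT_comp.
by rewrite lte_mul_pinfty.
Qed.

Lemma integral_mscale :
  \int[mscale k m]_(x in D) f x = k%:num%:E * \int[m]_(x in D) f x.
Proof.
have mf := measurable_int _ imf.
rewrite [LHS]integralE (ge0_integral_mscale _ _ _ (measurable_funepos mf))//.
rewrite (ge0_integral_mscale _ _ _ (measurable_funeneg mf))//.
rewrite -muleBr//; first by rewrite -integralE.
by rewrite fin_num_adde_defl// fin_numN integrable_neg_fin_num.
Qed.

End mscale.

(** * Integrals of exponentials over an interval *)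

Section exponential_integral.
Context (R : realType).

Lemma continuous_expR_affine (k c : R) : continuous (fun x => expR (k * (x - c))).
Proof.
move=> x; apply: continuous_comp; last exact: continuous_expR.
by apply: cvgM; [exact: cvg_cst|apply: cvgB; [exact: cvg_id|exact: cvg_cst]].
Qed.

Lemma integrable_expR_affine (k c a b : R) :
  lebesgue_measure.-integrable `[a, b] (EFin \o (fun x => expR (k * (x - c)))).
Proof.
apply: continuous_compact_integrable; first exact: segment_compact.
exact/continuous_subspaceT/continuous_expR_affine.
Qed.

Lemma integral_expR_affine (k c a b : R) : k != 0 -> a <= b ->
  (\int[lebesgue_measure]_(x in `[a, b]) (expR (k * (x - c)))%:E =
   ((expR (k * (b - c)) - expR (k * (a - c))) / k)%:E)%E.
Proof.
(* The degenerate interval is treated apart; the fundamental theorem of calculus is applied for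
   [a < b]. *)
move=> k0; rewrite le_eqVlt => /predU1P[->|ab].
  by rewrite set_itv1 integral_set1 subrr mul0r.
pose G := fun x => expR (k * (x - c)) / k.
have dG (x : R) : is_derive x (1 : R) G (expR (k * (x - c))).
  have dL : is_derive x (1 : R) (fun y => k * (y - c)) k.
    have -> : (fun y => k * (y - c)) = k \*: (id - cst c) by [].
    by apply: is_derive_eq; rewrite subr0; exact: mulr1.
  have -> : G = k^-1 \*: (expR \o (fun y => k * (y - c))).
    by apply/funext => y; rewrite /G/= mulrC.
  have dE := @is_derive1_comp _ expR (fun y => k * (y - c)) x _ _
    (is_derive_expR _) dL.
  by apply: is_derive_eq; rewrite /GRing.scale/= mulrC mulfK.
rewrite (@continuous_FTC2 _ _ G)//.
- by rewrite -EFinB /G mulrBl.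
- exact/continuous_subspaceT/continuous_expR_affine.
- have cG (x : R) : G y @[y --> x] --> G x.
    by apply: differentiable_continuous; apply/derivable1_diffP.
  split; first by move=> x _.
  + by apply: cvg_at_right_filter; exact: cG.
  + by apply: cvg_at_left_filter; exact: cG.
- by move=> x _; rewrite derive1E derive_val.
Qed.

End exponential_integral.

(** * Uniqueness and additivity of conditional expectations *)

Section sub_sigma_algebra.
Context d (Omega : measurableType d) (R : realType).
Variable G : set (set Omega).
Hypothesis sG : sigma_algebra setT G.

(** Taking [G] as the sigma-algebra of the domain gives access to the closure properties of
    measurable functions. *)
Lemma measurable_wrtP d' (T : measurableType d') (X : Omega -> T) :
  measurable_wrt G X <->
  measurable_fun setT (X : g_sigma_algebraType G -> T).
Proof.
split=> [mX _ B mB|mX B mB].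
  by rewrite setTI (measurable_g_measurableTypeE sG); exact: mX.
by have := mX measurableT B mB; rewrite setTI (measurable_g_measurableTypeE sG).
Qed.

Hypothesis Gm : G `<=` measurable.

Lemma measurable_wrt_fun d' (T : measurableType d') (X : Omega -> T) :
  measurable_wrt G X -> measurable_fun setT X.
Proof. by move=> mX _ B mB; rewrite setTI; exact/Gm/mX. Qed.

Variable P : probability Omega R.
Implicit Types X Y : Omega -> R.

(** The event [Y2 < Y1] lies in [G], so [Y1 - Y2] has integral zero over it; being positive there,
    it forces the event to be null. *)
Let cond_exp_le X Y1 Y2 : is_cond_exp P G X Y1 -> is_cond_exp P G X Y2 ->
  {ae P, forall w, Y1 w <= Y2 w}.
Proof.
move=> [_ iY1 mY1 E1] [_ iY2 mY2 E2]; pose A := [set w | Y2 w < Y1 w].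
have GA : G A.
  have := @measurable_fun_ltr _ (g_sigma_algebraType G) _ setT Y2 Y1
    ((measurable_wrtP _).1 mY2) ((measurable_wrtP _).1 mY1) measurableT [set true].
  rewrite setTI (measurable_g_measurableTypeE sG); apply.
  by [].
have mA : measurable A by exact: Gm.
have iA f : P.-integrable setT f -> P.-integrable A f.
  by move=> ?; apply: (integrableS measurableT).
have Y0 : (\int[P]_(w in A) ((Y1 w)%:E - (Y2 w)%:E) = 0)%E.
  rewrite integralB//; [|exact: iA|exact: iA].
  rewrite E1// E2// subee//.
  rewrite -E1//; apply: integrable_fin_num => //; exact: iA.
have : ae_eq P A (fun w => (Y1 w)%:E - (Y2 w)%:E)%E (cst 0%E).
  apply/ae_eq_integral_abs => //.
    by apply: emeasurable_funB; apply: measurable_funTS;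
      [exact: measurable_int _ iY1|exact: measurable_int _ iY2].
  rewrite -[RHS]Y0; apply: eq_integral => w /set_mem Aw.
  by rewrite gee0_abs// -EFinB lee_fin subr_ge0 ltW.
apply: filterS => w Aw; rewrite leNgt; apply/negP => Yw.
by have := Aw Yw; rewrite -EFinB => -[] /eqP; rewrite subr_eq0 gt_eqF.
Qed.

Lemma cond_exp_unique X Y1 Y2 : is_cond_exp P G X Y1 -> is_cond_exp P G X Y2 ->
  {ae P, forall w, Y1 w = Y2 w}.
Proof.
move=> XY1 XY2; apply: filterS2 (cond_exp_le XY1 XY2) (cond_exp_le XY2 XY1).
by move=> w Y12 Y21; apply/eqP; rewrite eq_le Y12.
Qed.

Lemma is_cond_expD (X1 X2 Y1 Y2 : Omega -> R) :
  is_cond_exp P G X1 Y1 -> is_cond_exp P G X2 Y2 ->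
  is_cond_exp P G (X1 \+ X2) (Y1 \+ Y2).
Proof.
move=> [iX1 iY1 mY1 E1] [iX2 iY2 mY2 E2]; split.
- exact: (integrableD measurableT iX1 iX2).
- exact: (integrableD measurableT iY1 iY2).
- by apply/measurable_wrtP; apply: measurable_funD; exact/measurable_wrtP.
- move=> A GA; have mA := Gm GA.
  have iA f : P.-integrable setT f -> P.-integrable A f.
    by move=> ?; apply: (integrableS measurableT).
  under eq_integral do rewrite EFinD.
  under [RHS]eq_integral do rewrite EFinD.
  rewrite !integralD ?E1 ?E2//; exact: iA.
Qed.

End sub_sigma_algebra.

(** * Conditional expectation of the spike process *)

Section spike.
Context (R : realType) d (Omega : measurableType d) (P : probability Omega R).
Variables (F : R -> set (set Omega)) (beta lambda : R) (nu : probability R R).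
Variable p : R.-ker Omega ~> (R * R)%type.
Hypotheses (hF : filtration F) (hbeta : 0 < beta) (hlambda : 0 < lambda).
Hypothesis hnu : nu.-integrable setT (EFin : R -> \bar R).
Hypothesis hp : filtered_poisson_random_measure P F lambda nu p.

Let sF (t : R) : 0 <= t -> sigma_algebra setT (F t).
Proof. by case: hF => + _ _; apply. Qed.
Let Fm (t : R) : 0 <= t -> F t `<=` measurable.
Proof. by case: hF => _ + _; apply. Qed.

Let prod : {measure set (measurableTypeR R * R) -> \bar R} :=
  (lebesgue_measure \x nu)%E.

Let measurable_idR :
  measurable_fun setT (id : measurableTypeR R * R -> (R * R)%type).
Proof. by []. Qed.

(* The product measure lives on [measurableTypeR R * R], whose sigma-algebra is
   that of [R * R] but with another display: it is transported along [id]. *)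
Let prodR : {measure set (R * R) -> \bar R} :=
  measure_function_pushforward__canonical__measure_function_Measure
    prod measurable_idR.

(** The jump intensity as a measure, without the cut to nonnegative times; both agree on sets of
    jumps at nonnegative times. *)
Let m : {measure set (R * R) -> \bar R} := mscale (NngNum (ltW hlambda)) prodR.
Let strip (a b : R) : set (R * R) := `]a, b] `*` setT.
Let jump (T : R) (z : R * R) : R := z.2 * expR (- (beta * (T - z.1))).

Let mstrip (a b : R) : measurable (strip a b). Proof. exact: measurableX. Qed.

Let strip_lty (a b : R) : (m (strip a b) < +oo)%E.
Proof.
rewrite /m /= /mscale/= /pushforward product_measure1E//.
rewrite [X in (_ * (_ * X))%E](@probability_setT _ _ _ nu) mule1.
rewrite lte_mul_pinfty ?lee_fin ?(ltW hlambda)//.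
rewrite [X in (X < _)%E](lebesgue_measure_itv `]a, b])/=.
by case: ifPn => _; rewrite ?ltry// -EFinB ltry.
Qed.

(** The event [p U = k] concerns jumps after [t], so it is independent of [A], and its probability
    is the Poisson weight. *)
Let poisson_strip (t T : R) A : 0 <= t -> F t A ->
  poisson_given P p m (strip t T) A.
Proof.
move=> t0 FA; split; first exact: Fm FA.
move=> U mU UD k; have [[pU _ _] _ indep] := hp.
have U0 : U `<=` `[0, +oo[ `*` setT.
  move=> z /UD[/=]; rewrite in_itv/= => /andP[tz _] _; split => //=.
  by rewrite in_itv/= andbT ltW// (le_lt_trans t0).
have mE : m U = jump_intensity lambda nu U.
  by rewrite /jump_intensity setIidl.
rewrite (indep t t0)//.
  rewrite mE pU// -mE; apply: le_lt_trans (strip_lty t T).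
  by rewrite le_measure ?inE.
apply: sub_sigma_algebra; exists U.
  split=> // z /UD[/=]; rewrite in_itv/= => /andP[tz _] _; split => //=.
  by rewrite in_itv/= andbT.
by exists [set k%:R%:E] => //; exact: emeasurable_set1.
Qed.

Let poisson_stripT (t T : R) : 0 <= t -> poisson_given P p m (strip t T) setT.
Proof.
move=> t0; apply: poisson_strip => //.
(* The whole space is in [F t] as the complement of the empty set. *)
by case: (sF t0) => F0 FD _; rewrite -(setD0 setT); exact: FD.
Qed.

Let jumpE (T : R) z : jump T z = expR (beta * (z.1 - T)) * z.2.
Proof. by rewrite /jump mulrC -mulrN opprB. Qed.

Let iexp (T t : R) : lebesgue_measure.-integrable `]t, T]
  (EFin \o (fun x => expR (beta * (x - T)))).
Proof.
apply: integrableS (integrable_expR_affine beta T t T) => //.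
exact: subset_itv_oc_cc.
Qed.

(** The jump function is an exponential of the time, integrable over a bounded interval, times the
    size, integrable under [nu]. *)
Let ijump0 (t T : R) :
  (lebesgue_measure \x nu)%E.-integrable (strip t T) (EFin \o jump T).
Proof.
have := @integrable_prod _ _ _ _ _ lebesgue_measure nu _ _ id
  (measurable_itv _) (iexp T t) hnu.
by congr (integrable _ _ _); apply/funext => z; rewrite /= jumpE.
Qed.

Let mjump (T : R) : measurable_fun setT (EFin \o jump T).
Proof.
apply/measurable_EFinP; apply: measurable_funM => //.
apply: measurableT_comp => //; apply: measurable_funN; apply: measurable_funM => //.
exact: measurable_funB.
Qed.

Let ijumpR (t T : R) : prodR.-integrable (strip t T) (EFin \o jump T).
Proof. exact: (integrable_pushforward measurable_idR _ (ijump0 t T)). Qed.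

Let ijump (t T : R) : m.-integrable (strip t T) (EFin \o jump T).
Proof. exact: integrable_mscale. Qed.

Let mean := \int[nu]_x x.

Let integral_jump (t T : R) : t <= T ->
  (\int[m]_(z in strip t T) (jump T z)%:E =
   (lambda * mean / beta * (1 - expR (- (beta * (T - t)))))%:E)%E.
Proof.
move=> tT; rewrite (integral_mscale _ (mstrip t T) (ijumpR t T)).
rewrite (integral_pushforward measurable_idR _ (ijump0 t T))//.
rewrite (eq_integral (fun z : measurableTypeR R * R =>
  (expR (beta * (z.1 - T)) * z.2)%:E)); last first.
  by move=> z _; rewrite /= jumpE.
rewrite [X in (_ * X)%E](@integral_prod _ _ _ _ _ lebesgue_measure nu _ _ id
  (measurable_itv _) (iexp T t) hnu).
(* Adding the endpoint [t], a null set, gives the closed interval of the exponential formula. *)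
rewrite integral_itv_obnd_cbnd; last first.
  by case/integrableP: (iexp T t).
rewrite integral_expR_affine// ?gt_eqF// subrr mulr0 expR0.
have -> : (\int[nu]_y y%:E)%E = mean%:E.
  by rewrite /mean /Rintegral fineK//; exact: integrable_fin_num.
rewrite -!EFinM; congr EFin.
rewrite -[t - T]opprB mulrN /=; ring.
Qed.

(** The integral involves only jumps up to [t], whose counts are measurable with respect to [F t];
    its positive and negative parts are treated separately. *)
Lemma spike_measurable (t : R) : 0 <= t -> measurable_wrt (F t) (spike beta p t).
Proof.
move=> t0; apply/(measurable_wrtP (sF t0)).
apply: (measurableT_comp (fine_measurable measurableT)).
under eq_fun do rewrite integralE.
have mj : measurable_fun (strip 0 t) (EFin \o jump t) by exact: measurable_funTS.
have mp U : measurable U -> U `<=` strip 0 t ->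
    measurable_fun setT ((fun w => p w U) : g_sigma_algebraType (F t) -> _).
  move=> mU Ut; apply/(measurable_wrtP (sF t0)).
  have [_ + _] := hp; apply => // z /Ut[/= zt _]; split => //=.
  exact: subset_itv_oc_cc zt.
apply: emeasurable_funB.
  apply: (@measurable_fun_integral_restr _ _ (g_sigma_algebraType (F t))
    _ _ p (strip 0 t)) => //.
  exact: measurable_funepos.
apply: (@measurable_fun_integral_restr _ _ (g_sigma_algebraType (F t))
    _ _ p (strip 0 t)) => //.
exact: measurable_funeneg.
Qed.

Lemma integrable_spike (t : R) : P.-integrable setT (EFin \o spike beta p t).
Proof.
exact: (integrable_kernel_Rintegral (mstrip 0 t) (strip_lty 0 t) (ijump 0 t)
  (poisson_stripT t (lexx 0))).
Qed.

(** A jump before [t] decays up to [t], then by the common factor of the remaining time [T - t]. The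
    identity is almost sure because splitting the integral requires integrability against [p w]. *)
Lemma spike_split (t T : R) : 0 <= t -> t <= T ->
  {ae P, forall w, spike beta p T w =
    expR (- (beta * (T - t))) * spike beta p t w
    + \int[p w]_(z in strip t T) jump T z}.
Proof.
move=> t0 tT.
have DU : strip 0 T = strip 0 t `|` strip t T.
  rewrite /strip (@itv_bndbnd_setU _ _ _ (BRight t))//= ?bnd_simp//.
  apply/seteqP; split => z /=; first by case=> -[z0|z0] _; [left|right].
  by move=> [[z0 _]|[z0 _]]; split => //; [left|right].
have := ae_integrable_kernel (mstrip 0 T) (strip_lty 0 T) (ijump 0 T)
  (poisson_stripT T (lexx 0)).
have := ae_integrable_kernel (mstrip 0 t) (strip_lty 0 t) (ijump 0 t)
  (poisson_stripT t (lexx 0)).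
apply: filterS2 => w it iT.
rewrite /spike -/(strip 0 T) DU Rintegral_setU//; last 2 first.
- by rewrite -DU.
- apply/disj_setPS => z [[/= + _] [/= + _]].
  rewrite !in_itv/= => /andP[_ zt] /andP[tz _].
  by rewrite ltNge zt in tz.
congr (_ + _); rewrite -[in RHS](RintegralZl _ (mstrip 0 t) it).
apply: eq_Rintegral => z _.
rewrite /jump mulrCA -expRD; congr (_ * expR _); ring.
Qed.

Lemma cond_exp_spike (t T : R) : 0 <= t -> t <= T ->
  is_cond_exp P (F t) (spike beta p T) (fun w =>
    expR (- (beta * (T - t))) * spike beta p t w
    + lambda * mean / beta * (1 - expR (- (beta * (T - t))))).
Proof.
move=> t0 tT; set e := expR _; set c := lambda * mean / beta * (1 - e).
have ie : P.-integrable setT (fun w => (e * spike beta p t w)%:E).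
  by under eq_fun do rewrite EFinM; exact: integrableZl (integrable_spike t).
have ic : P.-integrable setT (EFin \o cst c).
  exact: finite_measure_integrable_cst.
have iY := integrable_kernel_Rintegral (mstrip t T) (strip_lty t T)
  (ijump t T) (poisson_stripT T t0).
split.
- exact: integrable_spike.
- exact: (integrableD measurableT ie ic).
- apply/(measurable_wrtP (sF t0)); apply: measurable_funD => //.
  apply: measurable_funM => //; apply/(measurable_wrtP (sF t0)).
  exact: spike_measurable.
- move=> A FA; have mA := Fm t0 FA.
  have iA f : P.-integrable setT f -> P.-integrable A f.
    by move=> ?; apply: (integrableS measurableT).
  transitivity (\int[P]_(w in A) ((e * spike beta p t w)%:E +
      (\int[p w]_(z in strip t T) jump T z)%:E))%E; last first.
    apply: ae_eq_integral => //.
    + by apply: emeasurable_funD; apply: measurable_funTS;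
        [exact: measurable_int _ ie|exact: measurable_int _ iY].
    + by apply: measurable_funTS; exact: measurable_int _ (integrable_spike T).
    + by apply: filterS (spike_split t0 tT) => w -> _; rewrite EFinD.
  under eq_integral do rewrite EFinD.
  (* The term in [spike beta p t] is common to both sides; Campbell's formula on [A] evaluates the
     jumps after [t]. *)
  rewrite !integralD//; [|exact: iA..].
  rewrite (campbell (mstrip t T) (strip_lty t T) (ijump t T) (poisson_stripT T t0)
    (poisson_strip T t0 FA)).
  by rewrite integral_jump// integral_cst// muleC.
Qed.

End spike.

(** * Exchanging almost everywhere statements between sections *)

Section ae_sections.
Context d1 d2 (T1 : measurableType d1) (T2 : measurableType d2) (R : realType).
Variables (m1 : {sigma_finite_measure set T1 -> \bar R}).
Variables (m2 : {sigma_finite_measure set T2 -> \bar R}).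
Variables (D : set T1) (h : T1 * T2 -> R).
Hypotheses (mD : measurable D) (mh : measurable_fun (D `*` setT) h).
Local Open Scope ereal_scope.

Let mDT : measurable (D `*` [set: T2]). Proof. exact: measurableX. Qed.

(** Extension by zero makes [h] measurable on the whole product, where Tonelli's theorem is
    applied. *)
Let h0 z := ((h \_ (D `*` setT)) z)%:E.

Let h0E x y : D x -> h0 (x, y) = (h (x, y))%:E.
Proof. by move=> Dx; rewrite /h0 patchE mem_set. Qed.

Let mh0 : measurable_fun setT h0.
Proof. by apply/measurable_EFinP; apply/(measurable_restrictT _ mDT). Qed.

Lemma measurable_section y : measurable_fun D (fun x => h (x, y)).
Proof.
apply/measurable_EFinP.
apply: (eq_measurable_fun (fun x => h0 (x, y))).
  by move=> x /set_mem Dx; rewrite h0E.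
apply: measurable_funTS.
exact: (measurableT_comp mh0 (pair2_measurable y)).
Qed.

(** For each [x] the integral of [|h0|] in [y] vanishes. By Tonelli the integral in [x] then has
    zero integral in [y], so it vanishes for almost every [y]. *)
Lemma ae_section_eq0 : (forall x, D x -> {ae m2, forall y, h (x, y) = 0%R}) ->
  {ae m2, forall y, ae_eq m1 D (fun x => (h (x, y))%:E) (cst 0)}.
Proof.
move=> hx0.
have mk : measurable_fun setT (fun z => `|h0 z|) by exact: measurableT_comp.
have k0 z : 0 <= `|h0 z| by [].
have G0 : \int[m2]_y (\int[m1]_x `|h0 (x, y)|) = 0.
  rewrite -(@fubini_tonelli _ _ _ _ _ m1 m2 _ mk k0); apply: integral0_eq => x _.
  rewrite (ge0_ae_eq_integral (g := cst 0))//.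
  - by rewrite integral0.
  - exact: (measurableT_comp mk (pair1_measurable x)).
  - have [xD|xD] := pselect (D x).
      by apply: filterS (hx0 x xD) => y hy _; rewrite h0E// hy abse0.
    apply: nearW => y _; rewrite /h0 patchE memNset ?abse0//.
    by move=> [].
have /(ae_eq_integral_abs m2 measurableT) :
    measurable_fun setT (fun y => \int[m1]_x `|h0 (x, y)|).
  exact: (@measurable_fun_fubini_tonelli_G _ _ _ _ _ m1 _ mk k0).
under eq_integral do rewrite gee0_abs ?integral_ge0//.
move=> [/(_ G0) + _]; apply: filterS => y /(_ I) G0y.
apply: (ae_eq_integral_abs m1 mD _).1.
  by apply/measurable_EFinP; exact: measurable_section.
apply/eqP; rewrite eq_le integral_ge0// andbT -[leRHS]G0y.
rewrite [leLHS](eq_integral (fun x => `|h0 (x, y)|)); last first.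
  by move=> x /set_mem Dx; rewrite h0E.
apply: ge0_subset_integral => //.
exact: (measurableT_comp mk (pair2_measurable y)).
Qed.

End ae_sections.

Lemma integrable_ae_eq d (T : measurableType d) (R : realType)
    (m : {measure set T -> \bar R}) (D : set T) (f g : T -> \bar R) :
  measurable D -> measurable_fun D f -> ae_eq m D f g ->
  m.-integrable D g -> m.-integrable D f.
Proof.
move=> mD mf fg /integrableP[mg goo]; apply/integrableP; split => //.
rewrite (ge0_ae_eq_integral (g := (fun x => `|g x|)%E))//.
- exact: measurableT_comp.
- exact: measurableT_comp.
- by apply: filterS fg => x /[swap] Dx /(_ Dx) ->.
Qed.

(** * Forward prices and delivery prices *)

Theorem theorem12 (R : realType) (d : measure_display)
    (Omega : measurableType d) (Q : probability Omega R)
    (F : R -> set (set Omega)) (W mu sigma Xc : R -> Omega -> R)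
    (beta lambda : R) (nu : probability R R)
    (p : R.-ker Omega ~> (R * R)%type) (S : R -> Omega -> R)
    (hF : filtration F)
    (hW : standard_brownian_motion Q F W)
    (hXc : continuous_ito_semimartingale Q F W mu sigma Xc)
    (hbeta : 0 < beta) (hlambda : 0 < lambda)
    (hnu : nu.-integrable setT (EFin : R -> \bar R))
    (hp : filtered_poisson_random_measure Q F lambda nu p)
    (hpW : independent_of_process Q p W)
    (hS : forall t w, 0 <= t -> S t w = Xc t w + spike beta p t w) :
  let mean := \int[nu]_x x in
  let fbeta t T w :=
    expR (- (beta * (T - t))) * spike beta p t w
    + lambda * mean / beta * (1 - expR (- (beta * (T - t)))) in
  let fbeta_delivery t T theta w :=
    expR (- (beta * (T - t))) *
      ((1 - expR (- (beta * theta))) / (beta * theta)) * spike beta p t w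
    + lambda * mean / beta *
      (1 - expR (- (beta * (T - t))) *
             ((1 - expR (- (beta * theta))) / (beta * theta))) in
  (forall t T, 0 <= t -> t <= T ->
     forall fc, is_cond_exp Q (F t) (Xc T) fc ->
       is_cond_exp Q (F t) (S T) (fun w => fc w + fbeta t T w) /\
       (forall f, is_cond_exp Q (F t) (S T) f ->
          {ae Q, forall w, f w = fc w + fbeta t T w}))
  /\
  (forall t T theta, 0 <= t -> t <= T -> 0 < theta ->
     forall fc f : R -> Omega -> R,
       forward_curve Q (F t) Xc T (T + theta) fc ->
       forward_curve Q (F t) S T (T + theta) f ->
       {ae Q, forall w, lebesgue_measure.-integrable
                `[T, T + theta] (fun u => (fc u w)%:E)} ->
       {ae Q, forall w, lebesgue_measure.-integrable
                `[T, T + theta] (fun u => (f u w)%:E) /\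
              delivery_price T theta f w =
              delivery_price T theta fc w + fbeta_delivery t T theta w}).
Proof.
move=> mean fbeta fbeta_delivery.
have [sF Fm _] := hF.
have part1 t T : 0 <= t -> t <= T ->
     forall fc, is_cond_exp Q (F t) (Xc T) fc ->
       is_cond_exp Q (F t) (S T) (fun w => fc w + fbeta t T w) /\
       (forall f, is_cond_exp Q (F t) (S T) f ->
          {ae Q, forall w, f w = fc w + fbeta t T w}).
  move=> t0 tT fc Efc.
  have ES : is_cond_exp Q (F t) (S T) (fun w => fc w + fbeta t T w).
    have -> : S T = Xc T \+ spike beta p T.
      by apply/funext => w; rewrite hS//; exact: le_trans tT.
    apply: (is_cond_expD (sF _ t0) (Fm _ t0) Efc).
    exact: (cond_exp_spike hF hbeta hlambda hnu hp t0 tT).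
  by split => // f Ef; exact: (cond_exp_unique (sF _ t0) (Fm _ t0) Ef ES).
split; first exact: part1.
move=> t T theta t0 tT theta0 fc f [mfc Efc] [mf Ef] ifc.
set D := `[T, T + theta]%classic in ifc *.
have mspike : measurable_fun setT (spike beta p t).
  exact: (measurable_wrt_fun (Fm _ t0) (spike_measurable beta hF hp t0)).
pose c := lambda * mean / beta.
(* In the delivery time [u], the spike part is a constant plus a multiple of one exponential, which
   can be integrated explicitly. *)
have fbetaE u w : fbeta t u w =
    (spike beta p t w - c) * expR (- beta * (u - t)) + c.
  by rewrite /fbeta -/c mulNr; ring.
have mfbeta : measurable_fun (D `*` setT)
    (fun z : measurableTypeR R * Omega => fbeta t z.1 z.2).
  apply: measurable_funTS; under eq_fun do rewrite fbetaE.
  apply: measurable_funD => //; apply: measurable_funM.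
    apply: measurable_funB => //; exact: (measurableT_comp mspike measurable_snd).
  apply: measurableT_comp => //; apply: measurable_funM => //.
  apply: measurable_funB => //; exact: measurable_fst.
have mD : measurable (D : set (measurableTypeR R)) by exact: measurable_itv.
have mh : measurable_fun (D `*` setT)
    (fun z : measurableTypeR R * Omega =>
       f z.1 z.2 - (fc z.1 z.2 + fbeta t z.1 z.2)).
  by apply: measurable_funB => //; exact: measurable_funD.
have lD : lebesgue_measure D = theta%:E.
  by rewrite lebesgue_measure_itv/= lte_fin ltrDl theta0 -EFinB addrAC subrr add0r.
have ic : lebesgue_measure.-integrable D (EFin \o cst c).
  apply: continuous_compact_integrable; first exact: segment_compact.
  by apply: continuous_subspaceT => x; exact: cvg_cst.
have iexp r : lebesgue_measure.-integrable D
    (EFin \o (fun u => r * expR (- beta * (u - t)))).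
  exact: (integrableZl mD r (integrable_expR_affine (- beta) t T (T + theta))).
have ifbeta w : lebesgue_measure.-integrable D (fun u => (fbeta t u w)%:E).
  under eq_fun do rewrite fbetaE.
  exact: (integrableD mD (iexp (spike beta p t w - c)) ic).
have Rfbeta w : \int[lebesgue_measure]_(u in D) fbeta t u w =
    theta * fbeta_delivery t T theta w.
  under eq_Rintegral do rewrite fbetaE.
  rewrite (RintegralD mD (iexp _) ic) Rintegral_cst// [X in fine X]lD.
  rewrite (RintegralZl _ mD (integrable_expR_affine _ _ _ _)).
  rewrite /Rintegral integral_expR_affine ?oppr_eq0 ?gt_eqF ?lerDl ?ltW//=.
  rewrite /fbeta_delivery -/c addrAC [in X in expR X - _]mulrDr expRD !mulNr.
  by field; rewrite !gt_eqF.
(* The exceptional null set of the first part depends on [u]; joint measurability of the two curves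
   allows exchanging it for a single null set of [w], each other path agreeing at almost every
   [u]. *)
have : {ae Q, forall w, ae_eq lebesgue_measure D
    (fun u => (f u w - (fc u w + fbeta t u w))%:E) (cst 0%E)}.
  apply: (ae_section_eq0 lebesgue_measure mD mh) => u.
  rewrite /D/= in_itv/= => uT.
  have tu : t <= u by apply: le_trans tT _; case/andP: uT.
  apply: filterS ((part1 t u t0 tu _ (Efc u uT)).2 _ (Ef u uT)) => w /= ->.
  by rewrite subrr.
apply: filterS2 ifc => w ifc hw.
have ig : lebesgue_measure.-integrable D (fun u => (fc u w + fbeta t u w)%:E).
  by under eq_fun do rewrite EFinD; exact: integrableD.
have mfw : measurable_fun (D : set (measurableTypeR R)) (fun u => (f u w)%:E).
  by apply/measurable_EFinP; exact: (measurable_section mD mf w).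
have fg : ae_eq lebesgue_measure D (fun u => (f u w)%:E)
    (fun u => (fc u w + fbeta t u w)%:E).
  apply: filterS hw => u /[apply] /= -[] /eqP; rewrite subr_eq0 => /eqP ->//.
(* Integrability of the path of [f] is inherited from that of [fc] and the explicit spike part. *)
split; first exact: integrable_ae_eq ig.
rewrite /delivery_price -/D.
have -> : \int[lebesgue_measure]_(u in D) f u w =
          \int[lebesgue_measure]_(u in D) (fc u w + fbeta t u w).
  rewrite /Rintegral; congr fine; apply: ae_eq_integral => //.
  by case/integrableP: ig.
by rewrite (RintegralD mD ifc (ifbeta w)) mulrDr Rfbeta mulKf// gt_eqF.
Qed.
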